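(* Let $X$ be a Banach space such that its dual $X^*$ has Rademacher type $p\in(1,2]$ with constant $T_p(X^* )$. Let $k\ge1$ be an integer and set $$r_k(X)=6\,T_p(X^* )\,k^{-1+\frac1p}.$$ Let $\mathcal{F}_1,\dots,\mathcal{F}_k$ be finite non-empty families of convex sets in $X$. Assume that for every choice $K_i\in\mathcal{F}_i$, $i\in\{1,\dots,k\}$, the intersection $\mathbf{B}_X\cap\bigcap_{i=1}^kK_i$ is non-empty. Then there exist radii $r_1,\dots,r_k\ge 0$ with $$\frac{r_1+\dots+r_k}{k}\le r_k(X)$$ and a point $x\in X$ such that $$\operatorname{dist}(x,K)\le r_i\qquad\text{for all }K\in\mathcal{F}_i,\ i\in\{1,\dots,k\}.$$ In particular, there is an index $i_0\in\{1,\dots,k\}$ such that $$\operatorname{dist}(x,K)\le r_k(X)\qquad\text{for all }K\in\mathcal{F}_{i_0}.$$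
   Context: $\mathbf{B}_X$ denotes the (closed) unit ball of the Banach space $X$, and $\operatorname{dist}(x,K)=\inf_{z\in K}\|x-z\|$. The number $r_k(X)$ (the bound) is not to be confused with the radius $r_k$. Rademacher type: a Banach space $Y$ is of (Rademacher) type $p$, for some $p\ge1$, if there is a constant $T$ such that for every finite set $S$ of vectors in $Y$, the average norm of the $2^{|S|}$ vectors of the form $\sum_{s\in S}\pm s$ does not exceed $T\left(\sum_{s\in S}\|s\|^p\right)^{1/p}$. The minimal such constant $T$ is denoted $T_p(Y)$. *)

(* Defs.v *)
From HB Require Import structures.
From mathcomp Require Import all_boot all_order all_algebra finmap.
From mathcomp Require Import all_classical all_reals all_analysis.

Set Implicit Arguments.
Unset Strict Implicit.
Unset Printing Implicit Defensive.

Import Order.TTheory GRing.Theory Num.Theory.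
Import numFieldNormedType.Exports.

Local Open Scope classical_set_scope.
Local Open Scope ring_scope.

Definition dual_pred (R : realType) (X : normedModType R) :
    {pred X -> R^o} :=
  [pred f | `[< linear f /\ continuous f >]].
Arguments dual_pred {R} X.

Lemma dual_pred_submod_closed (R : realType) (X : normedModType R) :
  submod_closed (dual_pred X).
Proof.
split=> [|a f g /asboolP[lf cf] /asboolP[lg cg]]; apply/asboolP; split.
- by move=> a x y /=; rewrite scaler0 addr0.
- by move=> x; exact: (@cst_continuous X R^o 0 x).
- move=> b x y; rewrite !fctE lf lg !scalerDr !scalerA (mulrC a b).
  by rewrite addrACA.
- move=> x; apply: (@continuousD R R^o X (a \*: f) g x); last exact: cg.
  by apply: (@continuousZl_tmp R R^o X f a x); exact: cf.
Qed.

HB.instance Definition _ (R : realType) (X : normedModType R) :=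
  GRing.isSubmodClosed.Build _ _ (dual_pred X)
    (@dual_pred_submod_closed R X).

Record dual_space (R : realType) (X : normedModType R) := DualSpace {
  dual_fun :> X -> R^o;
  dual_funP : dual_fun \in dual_pred X }.

HB.instance Definition _ (R : realType) (X : normedModType R) :=
  [isSub for @dual_fun R X].
HB.instance Definition _ (R : realType) (X : normedModType R) :=
  [Choice of dual_space X by <:].
HB.instance Definition _ (R : realType) (X : normedModType R) :=
  [SubChoice_isSubLmodule of dual_space X by <:].

Definition dual_norm (R : realType) (X : normedModType R) (f : dual_space X) : R :=
  sup [set `|f x| | x in [set y : X | `|y| <= 1]].

Lemma dual_linear (R : realType) (X : normedModType R) (f : dual_space X) :
  linear f.
Proof. by have /asboolP[] := dual_funP f. Qed.

Lemma dual_continuous (R : realType) (X : normedModType R) (f : dual_space X) :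
  continuous f.
Proof. by have /asboolP[] := dual_funP f. Qed.

HB.instance Definition _ (R : realType) (X : normedModType R) (f : dual_space X) :=
  GRing.isLinear.Build R X R^o *:%R f (dual_linear f).

Lemma dual_norm_has_sup (R : realType) (X : normedModType R) (f : dual_space X) :
  has_sup [set `|f x| | x in [set y : X | `|y| <= 1]].
Proof.
split; first by exists `|f 0|, 0 => //=; rewrite normr0.
have /linear_bounded_continuous/bounded_funP/(_ 1)[M fM] :=
  @dual_continuous R X f.
exists M => _ [x /= x1 <-]; exact: fM.
Qed.

Lemma dual_norm_ub (R : realType) (X : normedModType R) (f : dual_space X) (x : X) :
  `|f x| <= dual_norm f * `|x|.
Proof.
have [->|x0] := eqVneq x 0; first by rewrite raddf0 !normr0 mulr0.
have nx0 : 0 < `|x| by rewrite normr_gt0.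
rewrite -ler_pdivrMr//; apply: (sup_upper_bound (dual_norm_has_sup f)).
exists (`|x|^-1 *: x).
  by rewrite /= normfZV.
by rewrite linearZ normrZ normfV normr_id mulrC.
Qed.

Lemma dual_norm_le (R : realType) (X : normedModType R) (f : dual_space X) (M : R) :
  (forall x, `|x| <= 1 -> `|f x| <= M) -> dual_norm f <= M.
Proof.
move=> fM; apply: ge_sup; first by case: (dual_norm_has_sup f).
by move=> _ [x /= x1 <-]; exact: fM.
Qed.

Lemma dual_norm_ge0 (R : realType) (X : normedModType R) (f : dual_space X) :
  0 <= dual_norm f.
Proof.
apply: (le_trans (normr_ge0 (f 0))).
apply: (sup_upper_bound (dual_norm_has_sup f)).
by exists 0 => //=; rewrite normr0.
Qed.

Lemma dual_norm_unit (R : realType) (X : normedModType R) (f : dual_space X)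
  (x : X) : `|x| <= 1 -> `|f x| <= dual_norm f.
Proof.
move=> x1; apply: (le_trans (dual_norm_ub f x)).
by rewrite ler_piMr// dual_norm_ge0.
Qed.

Lemma dual_normD (R : realType) (X : normedModType R) (f g : dual_space X) :
  dual_norm (f + g) <= dual_norm f + dual_norm g.
Proof.
apply: dual_norm_le => x x1; apply: (le_trans (ler_normD (f x) (g x))).
by apply: lerD; exact: dual_norm_unit.
Qed.

Lemma dual_normZ (R : realType) (X : normedModType R) (a : R) (f : dual_space X) :
  dual_norm (a *: f) = `|a| * dual_norm f.
Proof.
have leZ b (g : dual_space X) : dual_norm (b *: g) <= `|b| * dual_norm g.
  apply: dual_norm_le => x x1.
  rewrite [X in X <= _](_ : _ = `|b| * `|g x|); last exact: normrM.
  by rewrite ler_wpM2l// dual_norm_unit.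
apply/eqP; rewrite eq_le leZ/=.
have [->|a0] := eqVneq a 0; first by rewrite normr0 mul0r dual_norm_ge0.
rewrite -ler_pdivlMl ?normr_gt0// -normfV.
by rewrite -[X in dual_norm X <= _](scalerK a0); exact: leZ.
Qed.

Lemma dual_norm0_eq0 (R : realType) (X : normedModType R) (f : dual_space X) :
  dual_norm f = 0 -> f = 0.
Proof.
move=> f0; apply/val_inj/funext => x /=; apply/eqP; rewrite -normr_le0.
by rewrite (le_trans (dual_norm_ub f x))// f0 mul0r.
Qed.

HB.instance Definition _ (R : realType) (X : normedModType R) :=
  Lmodule_isNormed.Build R (dual_space X)
    (@dual_normD R X) (@dual_normZ R X) (@dual_norm0_eq0 R X).

Definition rademacher_average (R : realType) (Y : normedModType R)
    (S : {fset Y}) : R :=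
  (2 ^+ #|` S|)^-1 *
  \sum_(e : {ffun S -> bool}) `|\sum_(s : S) (-1) ^+ e s *: val s|.

(* The sign condition on [T] only matters when [Y] is the zero space, where
   every real number satisfies the inequality. *)
Definition is_type_constant (R : realType) (Y : normedModType R) (p T : R) :=
  0 <= T /\
  forall S : {fset Y},
    rademacher_average S <= T * (\sum_(s : S) `|val s| `^ p) `^ p^-1.

Definition has_rademacher_type (R : realType) (Y : normedModType R) (p : R) :=
  exists T, is_type_constant Y p T.

Definition type_constant (R : realType) (Y : normedModType R) (p : R) : R :=
  inf [set T | is_type_constant Y p T].

Lemma type_constant_ge0 (R : realType) (Y : normedModType R) (p : R) :
  has_rademacher_type Y p -> 0 <= type_constant Y p.
Proof. by move=> [T YT]; apply: lb_le_inf; [exists T|move=> ? []]. Qed.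

Lemma type_constant_min (R : realType) (Y : normedModType R) (p : R) :
  has_rademacher_type Y p ->
  is_type_constant Y p (type_constant Y p) /\
  forall T, is_type_constant Y p T -> type_constant Y p <= T.
Proof.
move=> Yp; have cmin : lbound [set T | is_type_constant Y p T]
    (type_constant Y p).
  by apply: ge_inf; exists 0 => T [].
split=> [|T /cmin//]; split=> [|S]; first exact: type_constant_ge0.
set V := (X in _ <= _ * X); have V0 : 0 <= V := powR_ge0 _ _.
have [V_gt0|V_le0] := ltP 0 V.
  rewrite -ler_pdivrMr//; apply: lb_le_inf => // T [_ /(_ S)].
  by rewrite -ler_pdivrMr.
have {V_le0}V_eq0 : V = 0 by apply/eqP; rewrite eq_le V_le0.
by have [T [_ /(_ S)]] := Yp; rewrite -/V V_eq0 !mulr0.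
Qed.

(* [inf] of the empty set is 0, so this is meant for a nonempty [K]. *)
Definition dist_set (R : realType) (X : normedModType R) (x : X) (K : set X) : R :=
  inf [set `|x - z| | z in K].

Definition type_radius (R : realType) (X : normedModType R) (p : R) (k : nat) : R :=
  6 * type_constant (dual_space X) p * k%:R `^ (-1 + p^-1).

(* Main.v *)
Require Import Defs.
From HB Require Import structures.
From mathcomp Require Import all_boot all_order all_algebra finmap.
From mathcomp Require Import all_classical all_reals all_analysis.
From mathcomp Require Import ring lra.

(** The theorem says that some [x] makes [\sum_i max_(K in F i) dist(x, K)] at
    most [6 T k^(1/p)], where [T] is the type constant of the dual; the maxima
    are then the radii.  Suppose that this sum is at least [v] at every [x].

    By Hahn-Banach, applied to the norm [\sum_i max_K |y_(i, K)|] on the power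
    of [X] indexed by the pairs [(i, K)] and to the convex set of all families
    [(x - z_(i, K))] with [z_(i, K)] in [K], the lower bound is certified by
    continuous functionals [phi_(i, K)]: for each [i] their norms sum to at
    most 1, altogether they sum to 0, and [- \sum phi_(i, K)(z_(i, K)) >= v]
    for every choice of [z_(i, K)] in [K] ([separating_functionals]).

    Up to spare mass, the norms of the [phi_(i, K)] are the probabilities of a
    random choice of one set [K_i] for each [i], independently in [i].  Write
    [phi_(i, K)] as its probability times a functional [f_(i, K)] of norm at
    most 1.  Then [g = \sum_i f_(i, K_i)] has mean 0, so symmetrization and the
    type inequality bound the mean of [|g|] by [2 T k^(1/p)]
    ([symmetrization], [rademacher_sum_le]).  On the other hand, each outcome
    of the choice comes with a point [x] of the unit ball in all the [K_i].
    For each pair [(i, K)] let [z_(i, K)] be the one among the finitely many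
    such points in [K] where [f_(i, K)] is largest.  For each outcome,
    [- \sum_i f_(i, K_i)(z_(i, K_i)) <= - g x <= |g|], and taking means gives
    [v <= 2 T k^(1/p)] ([sum_max_dist_bound]).

    So the infimum of the sum over [x] is at most [2 T k^(1/p)], and if [T > 0]
    then some [x] brings the sum below [6 T k^(1/p)].  If [T = 0], the dual is
    zero, and [X] is zero by Hahn-Banach ([trivial_of_type_constant0]). *)

Set Implicit Arguments.
Unset Strict Implicit.
Unset Printing Implicit Defensive.

Import Order.TTheory GRing.Theory Num.Theory.
Import numFieldNormedType.Exports.

Local Open Scope classical_set_scope.
Local Open Scope ring_scope.

(** * Linear functionals below a sublinear one *)

(** The second clause asks only for an inequality, which is the half to check
    for an infimum; [sublinearZ] gives the equality. *)
Definition sublinear (R : realType) (E : lmodType R) (p : E -> R) :=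
  (forall x y, p (x + y) <= p x + p y) /\
  (forall (t : R) x, 0 <= t -> p (t *: x) <= t * p x).

Lemma sublinear0 (R : realType) (E : lmodType R) (p : E -> R) :
  sublinear p -> p 0 = 0.
Proof.
move=> [pD pZ]; apply/eqP; rewrite eq_le; apply/andP; split.
  by have := pZ 0 0 (lexx 0); rewrite scale0r mul0r.
by have := pD 0 0; rewrite addr0 lerDl.
Qed.

Lemma sublinearZ (R : realType) (E : lmodType R) (p : E -> R) (t : R) x :
  sublinear p -> 0 <= t -> p (t *: x) = t * p x.
Proof.
move=> sp; have [pD pZ] := sp; rewrite le_eqVlt => /predU1P[<-|t0].
  by rewrite scale0r mul0r sublinear0.
apply/eqP; rewrite eq_le pZ ?(ltW t0)//=.
have ti0 : 0 <= t^-1 by rewrite invr_ge0 ltW.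
have := pZ _ (t *: x) ti0; rewrite scalerA mulVf ?gt_eqF// scale1r.
by rewrite ler_pdivlMl.
Qed.

Lemma sublinearN_ge (R : realType) (E : lmodType R) (p : E -> R) x :
  sublinear p -> - p (- x) <= p x.
Proof.
by move=> sp; have [pD _] := sp; have := pD x (- x);
  rewrite subrr sublinear0// => ?; lra.
Qed.

(** Tilting [p] by the rays through [A]: [q x] is the infimum of
    [p (x + t *: a) - t * v] over [t >= 0] and [a] in [A].  It is finite because
    [p (t *: a) >= t * v], and convexity of [A] makes it subadditive.  A linear
    functional below [q] is below [p] and at least [v] on [A].  The same
    construction with a single [a] shows that minimal sublinear functionals
    are odd. *)
Lemma sublinear_tilt (R : realType) (E : lmodType R) (p : E -> R)
    (A : set E) (v : R) :
  sublinear p -> A !=set0 ->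
  (forall a b (t : R), A a -> A b -> 0 <= t <= 1 -> A (t *: a + (1 - t) *: b)) ->
  (forall a, A a -> v <= p a) ->
  exists q : E -> R, [/\ sublinear q, forall x, q x <= p x &
    forall a, A a -> q (- a) <= - v].
Proof.
move=> sp [a0 Aa0] cA vA; have [pD pZ] := sp.
pose V x := [set p (x + t.1 *: t.2) - t.1 * v |
             t in [set t : R * E | 0 <= t.1 /\ A t.2]].
have Vlb x : lbound (V x) (- p (- x)).
  move=> _ [[t a] /= [t0 Aa] <-].
  have := pD (- x) (x + t *: a); rewrite addKr sublinearZ//.
  by have := ler_wpM2l t0 (vA _ Aa) => ? ?; lra.
have Vinf x : has_lbound (V x) by exists (- p (- x)); exact: Vlb.
have V0 x : V x !=set0.
  by exists (p (x + 0 *: a0) - 0 * v); exists (0, a0).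
have qle x t a : 0 <= t -> A a -> inf (V x) <= p (x + t *: a) - t * v.
  by move=> t0 Aa; apply: ge_inf => //; exists (t, a).
exists (fun x => inf (V x)); split.
- split=> [x y|t x].
    rewrite -lerBlDr; apply: lb_le_inf => // _ [[t a] /= [t0 Aa] <-].
    rewrite lerBlDl -lerBlDr.
    apply: lb_le_inf => // _ [[s b] /= [s0 Ab] <-]; rewrite lerBlDr.
    have [st0|st0] := eqVneq (s + t) 0.
      have -> : s = 0 by lra.
      have -> : t = 0 by lra.
      have := qle (x + y) 0 a (lexx _) Aa.
      rewrite !scale0r !mul0r !addr0 => /le_trans; apply.
      by rewrite !subr0 [leRHS]addrC pD.
    have st : 0 < s + t by rewrite lt_def st0/=; lra.
    (* [c] turns two points on rays through [A] into one: (s + t) c = s b + t a *)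
    pose c := (t / (s + t)) *: a + (1 - t / (s + t)) *: b.
    have Ac : A c.
      apply: cA => //; rewrite divr_ge0//= ?(ltW st)//.
      by rewrite ler_pdivrMr// mul1r; lra.
    have := qle (x + y) (s + t) c (ltW st) Ac => /le_trans; apply.
    have -> : (s + t) *: c = s *: b + t *: a.
      rewrite /c scalerDr !scalerA addrC mulrBr mulrCA divff// !mulr1.
      by rewrite addrK.
    have := pD (x + t *: a) (y + s *: b); rewrite addrACA [t *: a + _]addrC => ?; lra.
  rewrite le_eqVlt => /predU1P[<-|t0].
    have := qle 0 0 a0 (lexx _) Aa0.
    by rewrite !scale0r addr0 !mul0r subr0 sublinear0.
  rewrite -ler_pdivrMl//; apply: lb_le_inf => // _ [[s b] /= [s0 Ab] <-].
  rewrite ler_pdivrMl//.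
  have := qle (t *: x) (t * s) b (mulr_ge0 (ltW t0) s0) Ab.
  by rewrite -scalerA -scalerDr sublinearZ ?(ltW t0)// mulrBr mulrA.
- move=> x; have := qle x 0 a0 (lexx _) Aa0.
  by rewrite scale0r mul0r addr0 subr0.
- move=> a Aa; have := qle (- a) 1 a ler01 Aa.
  by rewrite scale1r addNr sublinear0// mul1r add0r.
Qed.

(** Zorn's lemma: the infimum of a chain of sublinear functionals below [p] is
    sublinear, and it is finite because [q x >= - q (- x) >= - p (- x)]. *)
Lemma minimal_sublinear (R : realType) (E : lmodType R) (p : E -> R) :
  sublinear p ->
  exists q : E -> R, [/\ sublinear q, forall x, q x <= p x &
    forall q', sublinear q' -> (forall x, q' x <= q x) ->
      forall x, q' x = q x].
Proof.
move=> sp.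
pose T := {q : E -> R | sublinear q /\ forall x, q x <= p x}.
pose below (q r : T) := `[< forall x, sval r x <= sval q x >].
have P : sublinear p /\ forall x, p x <= p x by split.
have [|||q qmin] := @ZL_preorder T (exist _ p P) below.
- by move=> q; apply/asboolP.
- move=> q r s /asboolP qr /asboolP rs; apply/asboolP => x.
  exact: le_trans (rs x) (qr x).
- move=> C totC; have [[q0 Cq0]|C0] := pselect (C !=set0); last first.
    by exists (exist _ p P) => s Cs; case: C0; exists s.
  pose V x := [set sval q x | q in C].
  have Vlb x : has_lbound (V x).
    exists (- p (- x)) => _ [[q [sq qp]] _ <-] /=.
    by apply: le_trans (sublinearN_ge _ sq); rewrite lerN2.
  have V0 x : V x !=set0 by exists (sval q0 x); exists q0.
  have Vle x q : C q -> inf (V x) <= sval q x.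
    by move=> Cq; apply: ge_inf => //; exists q.
  have sm : sublinear (fun x => inf (V x)) /\ forall x, inf (V x) <= p x.
    split; last first.
      by move=> x; apply: le_trans (Vle x _ Cq0) _; case: (svalP q0).
    split=> [x y|t x t0].
      rewrite -lerBlDr; apply: lb_le_inf => // _ [q Cq <-].
      rewrite lerBlDl -lerBlDr; apply: lb_le_inf => // _ [r Cr <-].
      rewrite lerBlDr [leRHS]addrC.
      (* the smaller of [q] and [r] is below [q] at [x] and below [r] at [y] *)
      have [/asboolP qr|/asboolP rq] := totC _ _ Cq Cr.
      + apply: le_trans (Vle _ _ Cr) _; have [[rD _] _] := svalP r.
        by apply: le_trans (rD x y) _; rewrite lerD2r qr.
      + apply: le_trans (Vle _ _ Cq) _; have [[qD _] _] := svalP q.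
        by apply: le_trans (qD x y) _; rewrite lerD2l rq.
    move: t0; rewrite le_eqVlt => /predU1P[<-|t0].
      rewrite scale0r mul0r; apply: le_trans (Vle 0 _ Cq0) _.
      by have [/sublinear0 -> _] := svalP q0.
    rewrite -ler_pdivrMl//; apply: lb_le_inf => // _ [q Cq <-].
    rewrite ler_pdivrMl//; apply: le_trans (Vle _ _ Cq) _.
    by have [[_ qZ] _] := svalP q; apply: qZ; exact: ltW.
  by exists (exist _ (fun x => inf (V x)) sm) => q Cq; apply/asboolP => x /=; exact: Vle.
have [sq qp] := svalP q.
exists (sval q); split=> // q' sq' q'q x.
have q'P : sublinear q' /\ forall x, q' x <= p x.
  by split=> // y; exact: le_trans (q'q y) (qp y).
have /asboolP qq' := qmin (exist _ q' q'P) (asboolT q'q).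
by apply/eqP; rewrite eq_le q'q qq'.
Qed.

(** Tilting [q] along [x], with bound [q x], cannot lower it; hence
    [q (- x) <= - q x].  An odd subadditive function is additive. *)
Lemma minimal_sublinear_linear (R : realType) (E : lmodType R) (q : E -> R) :
  sublinear q ->
  (forall q', sublinear q' -> (forall x, q' x <= q x) ->
     forall x, q' x = q x) ->
  forall (a : R) x y, q (a *: x + y) = a * q x + q y.
Proof.
move=> sq qmin; have [qD _] := sq.
have qN x : q (- x) = - q x.
  apply/eqP; rewrite eq_le; apply/andP; split.
    have [||a|q' [sq' q'q q'x]] := @sublinear_tilt _ _ q [set x] (q x) sq.
    - by exists x.
    - by move=> _ _ t -> -> _; rewrite -scalerDl addrC subrK scale1r.
    - by move=> ->.
    by rewrite -(qmin _ sq' q'q); exact: q'x.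
  by have := sublinearN_ge x sq; rewrite lerNl.
have qDe x y : q (x + y) = q x + q y.
  apply/eqP; rewrite eq_le qD/=.
  by have := qD (x + y) (- y); rewrite addrK qN => ?; lra.
move=> a x y; rewrite qDe; congr (_ + _).
have [a0|a0] := leP 0 a; first exact: sublinearZ.
rewrite -[a in LHS]opprK scaleNr -scalerN.
by rewrite sublinearZ// ?qN ?mulrNN// oppr_ge0 ltW.
Qed.

(** Hahn-Banach separation in a purely algebraic form: continuity of [L] is
    encoded in the bound by [p]. *)
Lemma sublinear_separation (R : realType) (E : lmodType R) (p : E -> R)
    (A : set E) (v : R) :
  sublinear p -> A !=set0 ->
  (forall a b (t : R), A a -> A b -> 0 <= t <= 1 -> A (t *: a + (1 - t) *: b)) ->
  (forall a, A a -> v <= p a) ->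
  exists L : E -> R, [/\ forall (a : R) x y, L (a *: x + y) = a * L x + L y,
    forall x, L x <= p x & forall a, A a -> v <= L a].
Proof.
move=> sp A0 cA vA; have [q [sq qp qA]] := sublinear_tilt sp A0 cA vA.
have [L [sL Lq Lmin]] := minimal_sublinear sq.
have lL := minimal_sublinear_linear sL Lmin.
exists L; split=> // [x|a Aa]; first exact: le_trans (Lq x) (qp x).
rewrite -lerN2; apply: le_trans (qA _ Aa).
by rewrite lerNl; apply: le_trans (sublinearN_ge a sL); rewrite lerN2.
Qed.

(** * Functionals that certify a lower bound *)

Lemma dual_of_bounded (R : realType) (X : normedModType R) (L : X -> R) (M : R) :
  (forall (a : R) x y, L (a *: x + y) = a * L x + L y) ->
  (forall x, L x <= M * `|x|) ->
  exists f : dual_space X, forall x, f x = L x.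
Proof.
move=> lL LM.
pose L' : {linear X -> R^o} :=
  HB.pack (L : X -> R^o) (GRing.isLinear.Build R X R^o *:%R L lL).
have absL x : `|L x| <= M * `|x|.
  rewrite ler_norml LM andbT lerNl.
  have -> : - L x = L (- x) by rewrite -[L]/(L' : X -> R^o) linearN.
  by rewrite -(normrN x).
have cL : continuous (L' : X -> R^o).
  apply/linear_bounded_continuous/bounded_funP => r; exists (`|M| * `|r|) => x xr.
  apply: le_trans (absL x) _; apply: le_trans (ler_norm _) _.
  rewrite normrM normr_id ler_wpM2l//; apply: le_trans xr _; exact: ler_norm.
have PL : (L : X -> R^o) \in dual_pred X by apply/asboolP; split.
by exists (DualSpace PL).
Qed.

Lemma dual_norm_adherent (R : realType) (X : normedModType R)
    (f : dual_space X) (e : R) : 0 < e ->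
  exists2 x : X, `|x| <= 1 & `|f| - e <= f x.
Proof.
move=> e0; have [_ [x /= x1 <-] /ltW fx] := sup_adherent e0 (dual_norm_has_sup f).
have [fx0|fx0] := leP 0 (f x).
  by exists x => //; rewrite ger0_norm in fx.
exists (- x); first by rewrite normrN.
by rewrite linearN -(ltr0_norm fx0).
Qed.

Lemma dual_sumE (R : realType) (X : normedModType R) (I : finType)
    (f : I -> dual_space X) (x : X) :
  (\sum_i f i) x = \sum_i f i x.
Proof. exact: (big_morph (fun g : dual_space X => g x : R)). Qed.

(** The norm to be dominated: a functional below it splits into functionals on
    the coordinates whose dual norms sum to at most 1 within each class [i]. *)
Definition sum_max_norm (R : realType) (X : normedModType R) (I J : finType)
    (y : {ffun I * J -> X}) : R :=
  \sum_i \big[Num.max/0]_j `|y (i, j)|.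

Lemma sum_max_norm_sublinear (R : realType) (X : normedModType R)
    (I J : finType) : sublinear (@sum_max_norm R X I J).
Proof.
split=> [x y|t x t0].
  rewrite -big_split/=; apply: ler_sum => i _.
  apply: bigmax_le => [|j _]; first by rewrite addr_ge0// bigmax_ge_id.
  rewrite ffunE; apply: le_trans (ler_normD _ _) _.
  by rewrite lerD// (le_bigmax _ (fun j => `|_ (i, j)|)).
rewrite mulr_sumr; apply: ler_sum => i _.
apply: bigmax_le => [|j _]; first by rewrite mulr_ge0// bigmax_ge_id.
rewrite ffunE normrZ ger0_norm// ler_wpM2l//.
by rewrite (le_bigmax _ (fun j => `|_ (i, j)|)).
Qed.

(** The dual side of the minimax problem of minimizing over [x] the sum of the
    largest distances in each class.  A functional below [sum_max_norm] and at
    least [v] on all families [(x - z i j)] has coordinates [phi i j]; it stays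
    bounded below while [x] runs through [X], so these sum to 0. *)
Lemma separating_functionals (R : realType) (X : normedModType R)
    (I J : finType) (G : I -> J -> set X) (v : R) :
  (forall i j, G i j !=set0) ->
  (forall i j a b (t : R), G i j a -> G i j b -> 0 <= t <= 1 ->
     G i j (t *: a + (1 - t) *: b)) ->
  (forall x z, (forall i j, G i j (z i j)) ->
     v <= \sum_i \big[Num.max/0]_j `|x - z i j|) ->
  exists phi : I -> J -> dual_space X,
    [/\ forall i, \sum_j `|phi i j| <= 1,
        \sum_i \sum_j phi i j = 0 &
        forall z, (forall i j, G i j (z i j)) ->
          v <= - \sum_i \sum_j phi i j (z i j)].
Proof.
move=> G0 cG vG.
pose A := [set y : {ffun I * J -> X} | exists x (z : I -> J -> X),
  (forall i j, G i j (z i j)) /\ y = [ffun u => x - z u.1 u.2]].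
have [z0 Gz0] : exists z : I -> J -> X, forall i j, G i j (z i j).
  by exists (fun i j => xget 0 (G i j)) => i j; apply: xgetPex; exact: G0.
have sp := @sum_max_norm_sublinear R X I J.
have [||y [x [z [Gz ->]]]|L [lL Lp LA]] := sublinear_separation (A := A) (v := v) sp.
- by exists [ffun u => 0 - z0 u.1 u.2], 0, z0.
- move=> _ _ t [x [z [Gz ->]]] [x' [z' [Gz' ->]]] t01.
  exists (t *: x + (1 - t) *: x'), (fun i j => t *: z i j + (1 - t) *: z' i j).
  split; first by move=> i j; exact: cG.
  by apply/ffunP => u; rewrite !ffunE !scalerBr opprD addrACA.
- apply: le_trans (vG x z Gz) _; apply: ler_sum => i _.
  by apply: le_bigmax2 => j _; rewrite ffunE.
have L0 : L 0 = 0.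
  by have := lL 1 0 0; rewrite scale1r mul1r addr0 => ?; lra.
have LD y y' : L (y + y') = L y + L y' by have := lL 1 y y'; rewrite scale1r mul1r.
pose single (u : I * J) (x : X) : {ffun I * J -> X} :=
  [ffun u' => if u' == u then x else 0].
have singleL u x : L (single u x) <= 1 * `|x|.
  apply: le_trans (Lp _) _; rewrite /sum_max_norm (bigD1 u.1)//= big1 ?addr0 ?mul1r; last first.
    move=> i iu; apply/eqP; rewrite eq_le bigmax_ge_id andbT.
    apply: bigmax_le => // j _; rewrite ffunE.
    by case: eqP => [iju|]; [rewrite -iju eqxx in iu|rewrite normr0].
  apply: bigmax_le => // j _; rewrite ffunE.
  by case: ifP => // _; rewrite normr0.
have single_linear u (a : R) x y :
    L (single u (a *: x + y)) = a * L (single u x) + L (single u y).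
  rewrite -lL; congr L; apply/ffunP => u'; rewrite !ffunE.
  by case: ifP => // _; rewrite scaler0 addr0.
have /choice[Phi PhiE] : forall u, exists f : dual_space X,
    forall x, f x = L (single u x).
  by move=> u; apply: dual_of_bounded (single_linear u) (singleL u).
have LE y : L y = \sum_i \sum_j Phi (i, j) (y (i, j)).
  rewrite (pair_bigA _ (fun i j => (Phi (i, j) (y (i, j)) : R)))/=.
  transitivity (\sum_u L (single u (y u))); last first.
    by apply: eq_bigr => -[i j] _; rewrite PhiE.
  rewrite -(big_morph L LD L0); congr L; apply/ffunP => u.
  rewrite sum_ffunE (bigD1 u)//= big1 ?addr0; first by rewrite ffunE eqxx.
  by move=> u' u'u; rewrite ffunE eq_sym (negbTE u'u).
exists (fun i j => Phi (i, j)); split.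
- move=> i; apply/ler_addgt0Pr => e e0.
  (* an error [d] for each [j], and one unit more to avoid dividing by 0 *)
  pose d := e / (#|J|%:R + 1).
  have d0 : 0 < d by rewrite divr_gt0// ltr_wpDl.
  have /choice[y Phiy] : forall j, exists y,
      `|y| <= 1 /\ `|Phi (i, j)| - d <= Phi (i, j) y.
    by move=> j; have [y y1 yd] := dual_norm_adherent (Phi (i, j)) d0; exists y.
  (* nearly norming vectors in the class [i], and 0 in the other classes *)
  pose w : {ffun I * J -> X} := [ffun u => if u.1 == i then y u.2 else 0].
  have : L w <= 1.
    apply: le_trans (Lp _) _; rewrite /sum_max_norm (bigD1 i)//= big1 ?addr0; last first.
      move=> i' ii'; apply/eqP; rewrite eq_le bigmax_ge_id andbT.
      by apply: bigmax_le => // j _; rewrite ffunE/= (negbTE ii') normr0.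
    apply: bigmax_le => // j _; rewrite ffunE/= eqxx.
    by have [] := Phiy j.
  rewrite LE (bigD1 i)//= [X in _ + X]big1 ?addr0; last first.
    move=> i' ii'; apply: big1 => j _.
    by rewrite ffunE/= (negbTE ii') linear0.
  have Jd : \sum_(j : J) d <= e.
    rewrite sumr_const -mulr_natl /d mulrA ler_pdivrMr ?ltr_wpDl//.
    by rewrite mulrC ler_wpM2l ?lerDl// ltW.
  move=> w1; rewrite -lerBlDr; apply: le_trans w1.
  apply: (@le_trans _ _ (\sum_j (`|Phi (i, j)| - d))).
    by rewrite sumrB lerD2l lerN2.
  apply: ler_sum => j _; rewrite ffunE/= eqxx.
  by have [] := Phiy j.
- apply/val_inj/funext => x /=.
  set S := \sum_i _.
  have vS y : v <= S y - \sum_i \sum_j Phi (i, j) (z0 i j).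
    have : v <= L [ffun u => y - z0 u.1 u.2] by apply: LA; exists y, z0.
    rewrite LE; move=> /le_trans; apply.
    rewrite dual_sumE -sumrB; apply: ler_sum => i _.
    rewrite dual_sumE -sumrB; apply: ler_sum => j _.
    by rewrite ffunE linearB.
  apply/eqP/negP => /negP Sx.
  set c := \sum_i _ in vS.
  (* a multiple of [x] at which [S] takes the value [v + c - 1] *)
  have := vS (((v + c - 1) / S x) *: x).
  rewrite linearZ/= -[_ *: _]/(_ * _) mulfVK// => ?; lra.
- move=> z Gz; have : v <= L [ffun u => 0 - z u.1 u.2] by apply: LA; exists 0, z.
  rewrite LE => /le_trans; apply.
  rewrite -sumrN; apply: ler_sum => i _; rewrite -sumrN; apply: ler_sum => j _.
  by rewrite ffunE sub0r linearN.
Qed.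

(** * Random choices *)

Definition product_weight (R : realType) (I J : finType) (lam : I -> J -> R)
    (kap : {ffun I -> J}) : R :=
  \prod_i lam i (kap i).

Lemma product_weight_ge0 (R : realType) (I J : finType) (lam : I -> J -> R) kap :
  (forall i j, 0 <= lam i j) -> 0 <= product_weight lam kap.
Proof. by move=> lam0; apply: prodr_ge0 => i _. Qed.

Lemma sum_product_weight (R : realType) (I J : finType) (lam : I -> J -> R) :
  (forall i, \sum_j lam i j = 1) -> \sum_kap product_weight lam kap = 1.
Proof.
by move=> lam1; rewrite -bigA_distr_bigA big1.
Qed.

(** Under independent choices of [kap i] with laws [lam i], the coordinate
    [kap i] has law [lam i]. *)
Lemma product_weight_marginal (R : realType) (V : lmodType R) (I J : finType)
    (lam : I -> J -> R) (i : I) (h : J -> V) :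
  (forall l, \sum_j lam l j = 1) ->
  \sum_kap product_weight lam kap *: h (kap i) = \sum_j lam i j *: h j.
Proof.
move=> lam1.
rewrite (partition_big (fun kap : {ffun I -> J} => kap i) xpredT)//=.
apply: eq_bigr => j _.
under eq_bigr => kap /eqP -> do [].
rewrite -scaler_suml; congr (_ *: _).
transitivity (\prod_l \sum_(j' | (l == i) ==> (j' == j)) lam l j').
  rewrite bigA_distr_big_dep; apply: eq_bigl => kap.
  apply/eqP/familyP => [kapi l|/(_ i)].
    by rewrite unfold_in; apply/implyP => /eqP ->; rewrite kapi.
  by rewrite unfold_in eqxx => /eqP.
rewrite (bigD1 i)//= eqxx/= big_pred1_eq big1 ?mulr1// => l /negbTE li.
by rewrite -[RHS](lam1 l); apply: eq_bigl => j'; rewrite li.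
Qed.

(** Since [\sum_i f i (kap' i)] has mean 0 for an independent copy [kap'] of
    [kap], the mean of [`|\sum_i f i (kap i)|] is at most that of
    [`|\sum_i (f i (kap i) - f i (kap' i))|].  Exchanging [kap i] and [kap' i]
    preserves the joint law and changes the sign of the [i]-th term, so all
    sign patterns give the same mean; averaging over them brings in the
    Rademacher sums of the vectors [f i (kap i) - f i (kap' i)], for fixed
    [kap] and [kap']. *)
Lemma symmetrization (R : realType) (Y : normedModType R) (I J : finType)
    (lam : I -> J -> R) (f : I -> J -> Y) (M C : R) :
  (forall i j, 0 <= lam i j) -> (forall i, \sum_j lam i j = 1) ->
  \sum_i \sum_j lam i j *: f i j = 0 -> (forall i j, `|f i j| <= M) ->
  (forall s : I -> Y, (forall i, `|s i| <= M + M) ->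
     \sum_(e : {ffun I -> bool}) `|\sum_i (-1) ^+ e i *: s i|
       <= 2 ^+ #|I| * C) ->
  \sum_kap product_weight lam kap * `|\sum_i f i (kap i)| <= C.
Proof.
move=> lam0 lam1 lamf fM typeC.
pose P := product_weight lam.
have P0 kap : 0 <= P kap by exact: product_weight_ge0.
have P1 : \sum_kap P kap = 1 by exact: sum_product_weight.
pose N (e : {ffun I -> bool}) (u : {ffun I -> J} * {ffun I -> J}) :=
  `|\sum_i (-1) ^+ e i *: (f i (u.1 i) - f i (u.2 i))|.
pose D := \sum_u P u.1 * P u.2 * N [ffun=> false] u.
have leD : \sum_kap P kap * `|\sum_i f i (kap i)| <= D.
  rewrite /D -(pair_bigA _ (fun k1 k2 => P k1 * P k2 * N [ffun=> false] (k1, k2))).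
  apply: ler_sum => kap _.
  under eq_bigr => kap' _ do rewrite -mulrA.
  rewrite -mulr_sumr ler_wpM2l//.
  have -> : \sum_i f i (kap i) =
      \sum_kap' P kap' *: \sum_i (f i (kap i) - f i (kap' i)).
    under [RHS]eq_bigr => kap' _ do rewrite sumrB scalerBr.
    rewrite sumrB -scaler_suml P1 scale1r -[LHS]subr0; congr (_ - _).
    rewrite -[LHS]lamf.
    transitivity (\sum_kap' \sum_i P kap' *: f i (kap' i)); last first.
      by apply: eq_bigr => kap' _; rewrite scaler_sumr.
    rewrite [RHS]exchange_big/=; apply: eq_bigr => i _.
    by rewrite (product_weight_marginal i (f i) lam1).
  apply: le_trans (ler_norm_sum _ _ _) _; apply: ler_sum => kap' _.
  rewrite normrZ ger0_norm// ler_wpM2l//.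
  suff -> : N [ffun=> false] (kap, kap') =
    `|\sum_i (f i (kap i) - f i (kap' i))| by [].
  by congr `|_|; apply: eq_bigr => i _; rewrite ffunE expr0 scale1r.
have De e : D = \sum_u P u.1 * P u.2 * N e u.
  pose sw (u : {ffun I -> J} * {ffun I -> J}) :=
    ([ffun i => if e i then u.2 i else u.1 i],
     [ffun i => if e i then u.1 i else u.2 i]).
  have swK : involutive sw.
    move=> [k1 k2]; rewrite /sw/=; congr pair; apply/ffunP => i;
      by rewrite !ffunE; case: (e i).
  rewrite /D (reindex_inj (inv_inj swK)); apply: eq_bigr => u _.
  congr (_ * _).
    rewrite /P /product_weight -!big_split/=; apply: eq_bigr => i _.
    by rewrite !ffunE; case: (e i) => //; rewrite mulrC.
  congr `|_|; apply: eq_bigr => i _; rewrite !ffunE expr0 scale1r.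
  by case: (e i); rewrite ?expr0 ?scale1r// expr1 scaleN1r opprB.
apply: le_trans leD _.
have two0 : (0 : R) < 2 ^+ #|I| by rewrite exprn_gt0.
rewrite -(ler_pM2l two0).
have -> : 2 ^+ #|I| * D = \sum_(e : {ffun I -> bool}) D.
  by rewrite sumr_const card_ffun card_bool -[RHS]mulr_natl natrX.
rewrite (eq_bigr _ (fun e _ => De e)) exchange_big/=.
under eq_bigr => u _ do rewrite -mulr_sumr.
apply: (@le_trans _ _ (\sum_u P u.1 * P u.2 * (2 ^+ #|I| * C))).
  apply: ler_sum => u _; rewrite ler_wpM2l ?mulr_ge0//; apply: typeC => i.
  by apply: le_trans (ler_normB _ _) _; rewrite lerD.
rewrite -mulr_suml.
rewrite -(pair_bigA _ (fun k1 k2 => P k1 * P k2))/=.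
under eq_bigr => k1 _ do rewrite -mulr_sumr P1 mulr1.
by rewrite P1 mul1r.
Qed.

(** * The type inequality for families with repetitions *)

(** The type inequality is about sets of vectors; for an injective family,
    sums over its image are sums over its indices. *)
Lemma rademacher_average_family (R : realType) (Y : normedModType R)
    (I : finType) (s : I -> Y) (g : Y -> R) : injective s ->
  let S := [fset s i | i in I]%fset in
  [/\ #|` S| = #|I|, \sum_(x : S) g (val x) = \sum_i g (s i) &
  \sum_(e : {ffun S -> bool}) `|\sum_(x : S) (-1) ^+ e x *: val x| =
  \sum_(e : {ffun I -> bool}) `|\sum_i (-1) ^+ e i *: s i| ].
Proof.
move=> sinj S.
have sS i : s i \in S by apply/imfsetP; exists i.
pose h i : S := [` sS i]%fset.
have [h' hK h'K] : bijective h.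
  apply: inj_card_bij => [i j /(congr1 val)/sinj//|].
  by rewrite -cardfE card_imfset//= -cardE.
split.
- by rewrite card_imfset//= -cardE.
- by rewrite (reindex h)//=; exists h' => x _.
rewrite (reindex (fun e : {ffun I -> bool} => [ffun x => e (h' x)])) /=; last first.
  exists (fun e : {ffun S -> bool} => [ffun i => e (h i)]) => e _;
    by apply/ffunP => x; rewrite !ffunE ?hK ?h'K.
apply: eq_bigr => e _; congr `|_|.
rewrite (reindex h)/=; last by exists h' => x _.
by apply: eq_bigr => i _; rewrite ffunE hK.
Qed.

Lemma rademacher_sum_injective_le (R : realType) (Y : normedModType R)
    (p T M : R) (I : finType) (s : I -> Y) :
  0 < p -> is_type_constant Y p T -> (forall i, `|s i| <= M) -> 0 <= M ->
  injective s ->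
  \sum_(e : {ffun I -> bool}) `|\sum_i (-1) ^+ e i *: s i|
    <= 2 ^+ #|I| * (T * (M * #|I|%:R `^ p^-1)).
Proof.
move=> p0 [T0 /(_ [fset s i | i in I]%fset)] typeT sM M0 sinj.
have [cardS sumS avgS] := rademacher_average_family (fun y => `|y| `^ p) sinj.
move: typeT; rewrite /rademacher_average cardS avgS sumS.
rewrite ler_pdivrMl ?exprn_gt0// => /le_trans; apply.
rewrite ler_pM2l ?exprn_gt0// ler_wpM2l//.
have -> : M * #|I|%:R `^ p^-1 = (#|I|%:R * M `^ p) `^ p^-1.
  by rewrite powRM ?powR_ge0// -powRrM divff ?gt_eqF// powRr1// mulrC.
have p0' := ltW p0; apply: ge0_ler_powR; rewrite ?invr_ge0 ?nnegrE//.
- by apply: sumr_ge0 => i _; rewrite powR_ge0.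
- by rewrite mulr_ge0// powR_ge0.
- rewrite mulr_natl -sumr_const; apply: ler_sum => i _.
  by apply: ge0_ler_powR; rewrite ?nnegrE.
Qed.

(** For two indices, at most one [t] makes the perturbed vectors coincide,
    because distinct indices move at distinct speeds along [h]. *)
Lemma near_injective_perturbation (R : realType) (Y : normedModType R)
    (I : finType) (s : I -> Y) (h : Y) : h != 0 ->
  \forall t \near (0 : R)^'+,
    injective (fun i => s i + (t * (enum_rank i)%:R) *: h).
Proof.
move=> h0.
suff : \forall t \near (0 : R)^'+, forall ij : I * I, ij.1 != ij.2 ->
    s ij.1 + (t * (enum_rank ij.1)%:R) *: h !=
    s ij.2 + (t * (enum_rank ij.2)%:R) *: h.
  apply: filterS => t tinj i j /eqP; apply: contraTeq => ij.
  exact: (tinj (i, j)).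
apply: filter_forall => -[i j] /=.
have [->|ij] := eqVneq i j; first by near=> t.
have [[t0 [t0_gt0 /eqP t0_bad]]|good] := pselect (exists t0, 0 < t0 /\
    s i + (t0 * (enum_rank i)%:R) *: h == s j + (t0 * (enum_rank j)%:R) *: h).
  near=> t => _; apply/negP => /eqP t_bad.
  have tt0 : t < t0 by near: t; exact: nbhs_right_lt.
  have /eqP : ((t - t0) * ((enum_rank i)%:R - (enum_rank j)%:R)) *: h = 0.
    have := congr2 (fun a b => a - b) t_bad t0_bad.
    rewrite /= !opprD (addrACA (s i) _ (- s i)) (addrACA (s j) _ (- s j)) !subrr !add0r => tt0E.
    by rewrite mulrBr !mulrBl !scalerBl tt0E subrr.
  rewrite scaler_eq0 (negbTE h0) orbF mulf_eq0 !subr_eq0 (lt_eqF tt0)/=.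
  by rewrite eqr_nat => /eqP/val_inj/enum_rank_inj/eqP; rewrite (negbTE ij).
near=> t => _; apply/negP => t_bad; apply: good; exists t; split=> //.
Unshelve. all: by end_near. Qed.

(** Both sides are continuous in the family, and injective families are dense
    as soon as the space is nonzero. *)
Lemma rademacher_sum_le (R : realType) (Y : normedModType R)
    (p T M : R) (I : finType) (s : I -> Y) :
  0 < p -> is_type_constant Y p T -> (forall i, `|s i| <= M) -> 0 <= M ->
  \sum_(e : {ffun I -> bool}) `|\sum_i (-1) ^+ e i *: s i|
    <= 2 ^+ #|I| * (T * (M * #|I|%:R `^ p^-1)).
Proof.
move=> p0 typeT sM M0; have [T0 _] := typeT.
have [Ytriv|/existsNP[h /eqP h0]] := pselect (forall y : Y, y = 0).
  rewrite big1; first by rewrite !mulr_ge0// powR_ge0.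
  by move=> e _; rewrite (Ytriv (\sum_i _)) normr0.
set k := #|I|; set K := k%:R `^ p^-1; set B := (X in _ <= X).
pose c := k%:R * `|h|.
have c0 : 0 <= c by rewrite mulr_ge0.
pose C := 2 ^+ k * (T * (c * K)) + 2 ^+ k * (k%:R * c).
have C0 : 0 <= C by rewrite addr_ge0// !mulr_ge0// powR_ge0.
(* [t * c] bounds every displacement, and [C] collects its two effects: on the
   bound [M], and on the sums themselves *)
have step (t : R) : 0 <= t ->
    injective (fun i => s i + (t * (enum_rank i)%:R) *: h) ->
    \sum_(e : {ffun I -> bool}) `|\sum_i (-1) ^+ e i *: s i| <= B + t * C.
  move=> t0 tinj.
  have dle (i : I) : `|(t * (enum_rank i)%:R) *: h| <= t * c.
    rewrite normrZ ger0_norm ?mulr_ge0// -mulrA ler_wpM2l// ler_wpM2r//.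
    by rewrite ler_nat; exact: ltnW (ltn_ord _).
  have := @rademacher_sum_injective_le _ _ _ _ (M + t * c) _ _ p0 typeT _ _ tinj.
  have stM (i : I) : `|s i + (t * (enum_rank i)%:R) *: h| <= M + t * c.
    by apply: le_trans (ler_normD _ _) _; rewrite lerD.
  move=> /(_ stM); rewrite addr_ge0 ?mulr_ge0// => /(_ isT) le1.
  apply: (@le_trans _ _ (\sum_(e : {ffun I -> bool})
      (`|\sum_i (-1) ^+ e i *: (s i + (t * (enum_rank i)%:R) *: h)|
       + k%:R * (t * c)))).
    apply: ler_sum => e _.
    have -> : \sum_i (-1) ^+ e i *: s i =
        \sum_i (-1) ^+ e i *: (s i + (t * (enum_rank i)%:R) *: h)
        - \sum_i (-1) ^+ e i *: ((t * (enum_rank i)%:R) *: h).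
      by rewrite -sumrB; apply: eq_bigr => i _; rewrite -scalerBr addrK.
    apply: le_trans (ler_normB _ _) _; rewrite lerD2l.
    apply: le_trans (ler_norm_sum _ _ _) _.
    rewrite mulr_natl -sumr_const; apply: ler_sum => i _.
    by rewrite normrZ normrX normrN normr1 expr1n mul1r.
  rewrite big_split/= sumr_const card_ffun card_bool -/k -[_ *+ _]mulr_natl natrX.
  have -> : B + t * C = 2 ^+ k * (T * ((M + t * c) * K)) + 2 ^+ k * (k%:R * (t * c)).
    by rewrite /B /C; ring.
  by rewrite lerD2r.
apply/ler_addgt0Pr => e e0.
near (0 : R)^'+ => t.
have t0 : 0 < t by [].
have te : t * (C + 1) <= e.
  rewrite -ler_pdivlMr ?ltr_wpDl//.
  by near: t; apply: nbhs_right_le; rewrite divr_gt0// ltr_wpDl.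
apply: (le_trans (step t (ltW t0) _)).
  by near: t; exact: near_injective_perturbation.
by rewrite lerD2l (le_trans _ te)// ler_wpM2l ?lerDl// ltW.
Unshelve. all: by end_near. Qed.

(** * The bound for independent choices, and the theorem *)

(** The core of the proof: a lower bound on all sums of largest distances is at
    most the mean norm of a centered sum of [#|I|] independent functionals in
    the unit ball of the dual. *)
Lemma sum_max_dist_bound (R : realType) (X : normedModType R)
    (p T : R) (I J : finType) (j0 : J) (G : I -> J -> set X) (v : R) :
  0 < p -> is_type_constant (dual_space X) p T ->
  (forall i j a b (t : R), G i j a -> G i j b -> 0 <= t <= 1 ->
     G i j (t *: a + (1 - t) *: b)) ->
  (forall kap : {ffun I -> J}, exists x, `|x| <= 1 /\ forall i, G i (kap i) x) ->
  (forall x z, (forall i j, G i j (z i j)) ->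
     v <= \sum_i \big[Num.max/0]_j `|x - z i j|) ->
  v <= T * (2 * #|I|%:R `^ p^-1).
Proof.
move=> p0 typeT cG /choice[xx xxG] vG.
have G0 i j : G i j !=set0.
  exists (xx [ffun=> j]); have [_ /(_ i)] := xxG [ffun=> j].
  by rewrite ffunE.
have [phi [phi1 phi0 vphi]] := separating_functionals G0 cG vG.
(* the mass missing in the class [i] goes to [j0] *)
pose lam i j := `|phi i j| + (j == j0)%:R * (1 - \sum_j' `|phi i j'|).
pose f i j : dual_space X := (lam i j)^-1 *: phi i j.
have phi_lam i j : `|phi i j| <= lam i j.
  by rewrite lerDl mulr_ge0// subr_ge0.
have lam0 i j : 0 <= lam i j by exact: le_trans (phi_lam i j).
have lam1 i : \sum_j lam i j = 1.
  rewrite big_split/= -mulr_suml.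
  have -> : \sum_j (j == j0)%:R = 1 :> R.
    by rewrite (bigD1 j0)//= eqxx big1 ?addr0// => j /negbTE ->.
  by rewrite mul1r addrC subrK.
have lamf i j : lam i j *: f i j = phi i j.
  have [lamij|lamij] := eqVneq (lam i j) 0; last first.
    by rewrite scalerA divff// scale1r.
  rewrite lamij scale0r; apply/esym/normr0_eq0/eqP.
  by rewrite eq_le normr_ge0 andbT -lamij.
have f1 i j : `|f i j| <= 1.
  rewrite normrZ normfV ger0_norm//.
  have [->|lamij] := eqVneq (lam i j) 0; first by rewrite invr0 mul0r.
  by rewrite mulrC ler_pdivrMr ?mul1r// lt_def lamij lam0.
(* among the chosen points that lie in [G i j], one with the largest [f i j] *)
have zP i j : exists z, G i j z /\
    forall kap : {ffun I -> J}, kap i = j -> f i j (xx kap) <= f i j z.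
  have k0 : [ffun=> j] i == j by rewrite ffunE.
  pose km := [arg max_(k > [ffun=> j] | k i == j) (f i j (xx k) : R)]%O.
  have [kE kmax] : km i = j /\
      forall k : {ffun I -> J}, k i = j -> f i j (xx k) <= f i j (xx km).
    rewrite /km; case: Order.TotalTheory.arg_maxP => // k /eqP kij kmax; split=> // k' /eqP.
    exact: kmax.
  exists (xx km); split=> //.
  by have [_ /(_ i)] := xxG km; rewrite kE.
have [z {}zP] : exists z : I -> J -> X, forall i j, G i j (z i j) /\
    forall kap : {ffun I -> J}, kap i = j -> f i j (xx kap) <= f i j (z i j).
  pose zi i := choice (zP i).
  by exists (fun i => projT1 (zi i)) => i; exact: (projT2 (zi i)).
pose P := product_weight lam.
apply: (@le_trans _ _ (\sum_kap P kap * `|\sum_i f i (kap i)|)); last first.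
  apply: (symmetrization (M := 1)) => //.
    by rewrite -[RHS]phi0; apply: eq_bigr => i _; apply: eq_bigr => j _.
  by move=> s sM; apply: rademacher_sum_le.
apply: le_trans (vphi z _) _; first by move=> i j; have [] := zP i j.
have -> : \sum_i \sum_j phi i j (z i j) =
    \sum_kap P kap * \sum_i f i (kap i) (z i (kap i)).
  under [RHS]eq_bigr => kap _ do rewrite mulr_sumr.
  rewrite [RHS]exchange_big/=; apply: eq_bigr => i _.
  rewrite (@product_weight_marginal _ R^o _ _ _ i (fun j => f i j (z i j)))//.
  by apply: eq_bigr => j _; rewrite -lamf.
rewrite -sumrN; apply: ler_sum => kap _; rewrite -mulrN ler_wpM2l//.
  exact: product_weight_ge0.
have [xk1 _] := xxG kap.
apply: (@le_trans _ _ (- (\sum_i f i (kap i)) (xx kap))).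
  rewrite lerN2 dual_sumE; apply: ler_sum => i _.
  by have [_] := zP i (kap i); apply.
by apply: le_trans (dual_norm_unit _ xk1); rewrite -normrN ler_norm.
Qed.

(** A zero type constant kills each functional, by the inequality for one
    vector; the functional that norms [x] then shows that [x] is 0. *)
Lemma trivial_of_type_constant0 (R : realType) (X : normedModType R) (p : R) :
  0 < p -> is_type_constant (dual_space X) p 0 -> forall x : X, x = 0.
Proof.
move=> p0 type0 x; apply/eqP/negP => /negP x0.
have sn : sublinear (fun y : X => `|y|).
  by split=> [y z|t y t0]; rewrite ?ler_normD// normrZ ger0_norm.
have [||_ ->//|L [lL Ln Lx]] := sublinear_separation (A := [set x]) (v := `|x|) sn.
- by exists x.
- by move=> _ _ t -> -> _; rewrite -scalerDl addrC subrK scale1r.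
have [f fL] : exists f : dual_space X, forall y, f y = L y.
  by apply: (dual_of_bounded (M := 1)) lL _ => y; rewrite mul1r.
have := @rademacher_sum_le _ _ p 0 `|f| unit (fun=> f) p0 type0 (fun=> lexx _).
move=> /(_ (normr_ge0 _)); rewrite mul0r mulr0 => sum_le0.
suff : `|f| <= 0.
  rewrite normr_le0 => /eqP f0; have := Lx x erefl.
  by rewrite -fL f0 /= normr_le0 (negbTE x0).
apply: le_trans sum_le0; rewrite [leRHS](bigD1 [ffun=> false])//=.
rewrite [X in _ <= `|X| + _](_ : _ = f) ?lerDl ?sumr_ge0//.
rewrite (eq_bigr (fun=> f)) ?sumr_const ?card_unit// => i _.
by rewrite ffunE expr0 scale1r.
Qed.

Lemma dist_set_le (R : realType) (X : normedModType R) (x z : X) (K : set X) :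
  K z -> dist_set x K <= `|x - z|.
Proof.
move=> Kz; apply: ge_inf; last by exists z.
by exists 0 => _ [y _ <-].
Qed.

(** All families are enumerated, with repetitions, by the same finite type, so
    that a choice of one set from each is a function between finite types. *)
Lemma finite_set_enum (U : choiceType) (I : finType) (F : I -> set U) :
  (forall i, finite_set (F i)) -> (forall i, F i !=set0) ->
  exists (m : nat) (G : I -> 'I_m.+1 -> U),
    (forall i j, F i (G i j)) /\ (forall i u, F i u -> exists j, G i j = u).
Proof.
move=> finF F0.
have /choice[s sF] : forall i, exists s : seq U, F i = [set` s].
  by move=> i; exact/finite_seqP.
have /choice[u0 u0F] : forall i, exists u, F i u by [].
exists (\max_i size (s i)), (fun i j => nth (u0 i) (s i) j); split=> [i j|i u].
  have [js|js] := ltnP j (size (s i)); last by rewrite nth_default.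
  by rewrite sF /=; exact: mem_nth.
rewrite {1}sF /= => us.
have lt_m : (index u (s i) < (\max_i size (s i)).+1)%N.
  by rewrite ltnS (leq_trans (index_size _ _))// (leq_bigmax i).
by exists (Ordinal lt_m); rewrite nth_index.
Qed.

Theorem theorem1p2 (R : realType) (X : completeNormedModType R) (p : R)
    (p_gt1 : 1 < p) (p_le2 : p <= 2) (typeX : has_rademacher_type (dual_space X) p)
    (k : nat) (k_ge1 : (1 <= k)%N) (F : 'I_k -> set (set X))
    (F_finite : forall i, finite_set (F i))
    (F_nonempty : forall i, F i !=set0)
    (F_convex : forall i K, F i K -> convex_set (K : set (convex_lmodType X)))
    (F_meet : forall K : 'I_k -> set X, (forall i, F i (K i)) ->
      closed_ball (0 : X) 1 `&` \bigcap_i K i !=set0) :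
  exists (r : 'I_k -> R) (x : X),
    [/\ forall i, 0 <= r i,
        (\sum_(i < k) r i) / k%:R <= type_radius X p k,
        forall i K, F i K -> dist_set x K <= r i
      & exists i0 : 'I_k, forall K, F i0 K -> dist_set x K <= type_radius X p k].
Proof.
have p0 : 0 < p by exact: lt_trans p_gt1.
have k0 : (0 : R) < k%:R by rewrite ltr0n.
have [typeT _] := type_constant_min typeX.
have [m [G [FG GF]]] := finite_set_enum F_finite F_nonempty.
set T := type_constant (dual_space X) p in typeT *.
have [T0 _] := typeT.
pose v : R := T * (6 * k%:R `^ p^-1).
have radiusE : type_radius X p k = v / k%:R.
  rewrite /type_radius -/T powRD; last by apply/implyP => _; rewrite gt_eqF.
  by rewrite powRN powRr1 ?ltW// /v; ring.
have meetG (kap : {ffun 'I_k -> 'I_m.+1}) :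
    exists x, `|x| <= 1 /\ forall i, G i (kap i) x.
  have [x [x1 xG]] := F_meet (fun i => G i (kap i)) (fun i => FG i _).
  exists x; split; last by move=> i; exact: xG.
  by move: x1; rewrite closed_ballE// /closed_ball_/= sub0r normrN.
have cG i j a b (t : R) : G i j a -> G i j b -> 0 <= t <= 1 ->
    G i j (t *: a + (1 - t) *: b).
  move=> Ga Gb /andP[t_ge0 t_le1]; apply/set_mem.
  have := F_convex i _ (FG i j) a b (Itv01 t_ge0 t_le1) (mem_set Ga) (mem_set Gb).
  by [].
suff [x [z [Gz zv]]] : exists x (z : 'I_k -> 'I_m.+1 -> X),
    (forall i j, G i j (z i j)) /\ \sum_i \big[Num.max/0]_j `|x - z i j| <= v.
  pose r i := \big[Num.max/0]_j `|x - z i j|.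
  have distr i K : F i K -> dist_set x K <= r i.
    move=> /GF[j <-]; apply: le_trans (dist_set_le x (Gz i j)) _.
    exact: (le_bigmax _ (fun j => `|x - z i j|)).
  have r_le : (\sum_i r i) / k%:R <= type_radius X p k.
    by rewrite radiusE ler_pM2r ?invr_gt0.
  exists r, x; split=> //; first by move=> i; exact: bigmax_ge_id.
  apply: contrapT => /forallNP noi.
  have : \sum_(i < k) type_radius X p k < \sum_i r i.
    apply: ltr_sum; first by apply/hasP; exists (Ordinal k_ge1).
    move=> i _; rewrite ltNge; apply/negP => ri; apply: (noi i) => K FK.
    exact: le_trans (distr _ _ FK) ri.
  rewrite sumr_const card_ord -mulr_natr.
  by rewrite ltNge -ler_pdivrMr// r_le.
have [T_gt0|] := ltP 0 T.
  (* the gap between the constants 2 and 6 makes up for an infimum over [x] that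
     need not be attained *)
  apply: contrapT => nox.
  have : v <= T * (2 * #|'I_k|%:R `^ p^-1).
    apply: (sum_max_dist_bound ord0 p0 typeT cG meetG) => x z Gz.
    by rewrite leNgt; apply/negP => /ltW zv; apply: nox; exists x, z.
  rewrite card_ord /v ler_pM2l// ler_pM2r ?powR_gt0//.
  lra.
move=> T_le0; have T_eq0 : T = 0 by apply/eqP; rewrite eq_le T_le0.
have Xtriv : forall x : X, x = 0.
  by apply: (trivial_of_type_constant0 p0); rewrite -T_eq0.
exists 0, (fun _ _ => 0); split.
  move=> i j; have [x [_ /(_ i)]] := meetG [ffun=> j].
  by rewrite ffunE (Xtriv x).
rewrite big1 /v ?T_eq0 ?mul0r// => i _.
by apply/eqP; rewrite eq_le bigmax_ge_id andbT bigmax_le// => j _; rewrite subr0 normr0.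
Qed.
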